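(* Under the model and assumptions (A1)--(A3), (B1)--(B6) in the context, let $\hat\theta_n^\phi$ be a minimum $\phi$-divergence estimator which is a BAN estimator of the parameter $\theta_0$. Then for every $p\in[0,1]$, $$qZ\left(p;Q_{\hat\theta_n^\phi}\right)\xrightarrow{P} qZ(p;Q_{\theta_0})\qquad\text{and}\qquad qD\left(p;Q_{\hat\theta_n^\phi}\right)\xrightarrow{P} qD(p;Q_{\theta_0})$$ as $n\to\infty$.
   Context: Model. $X_1,\ldots,X_n$ are iid nonnegative random variables with cumulative distribution function $F_{\theta_0}$, an element of a family $\{F_\theta:\theta\in\Theta\}$, $\Theta\subset\mathbb{R}^s$. Let $0=c_0<c_1<\cdots<c_{k-1}<c_k=\infty$ be fixed, so that $[0,c_1),[c_1,c_2),\ldots,[c_{k-1},\infty)$ is a partition of $[0,\infty)$ into $k$ intervals, with $k>s+1$. Only the interval containing each $X_j$ is observed. Let $g(\theta)=(g_1(\theta),\ldots,g_k(\theta))$, $g_i(\theta)=F_\theta(c_i)-F_\theta(c_{i-1})$ (with $F_\theta(\infty)=1$), and $\Delta_k=\{(p_1,\ldots,p_k): p_i\ge 0,\ \sum_{i=1}^k p_i=1\}$. Let $\Pi_0=g(\Theta)\subset\Delta_k$. Let $P=(p_1,\ldots,p_k)$ be the vector of observed frequencies, $p_i=\frac1n\sum_{j=1}^n \mathbf{1}\{X_j\in[c_{i-1},c_i)\}$. Assumptions. (A1) For every $\theta\in\Theta$, $F_\theta$ is absolutely continuous and strictly increasing on $[0,\infty)$, and $F_\theta(0)=0$. (A2)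 The true value $\theta_0$ of the $s$-dimensional parameter is an interior point of $\Theta$, which is a compact subset of $\mathbb{R}^s$. (A3) For every $p\in(0,1)$, $Q_\theta(p)=F_\theta^{-1}(p)$ is a continuous function of $\theta$. (B1) $g_i(\theta_0)>0$ for $i=1,\ldots,k$. (B2) $g:\Theta\to\Delta_k$ is totally differentiable at $\theta_0$: the partial derivatives of each $g_i$ with respect to each $\theta_j$ exist at $\theta_0$ and $g(\theta)=g(\theta_0)+\frac{\partial g(\theta_0)}{\partial\theta}(\theta-\theta_0)+o(\|\theta-\theta_0\|)$ as $\theta\to\theta_0$, where $\frac{\partial g(\theta_0)}{\partial\theta}$ is the $k\times s$ matrix with $(i,j)$ entry $\frac{\partial g_i(\theta_0)}{\partial\theta_j}$. (B3) The Jacobian matrix $\frac{\partial g(\theta_0)}{\partial\theta}$ has full rank $s$. (B4) The inverse mapping $g^{-1}:\Pi_0\to\Theta$ (assumed to exist) is continuous at $g(\theta_0)$. (B5) $g:\Theta\to\Delta_k$ is continuous at every $\theta\in\Theta$. (B6) $g$ has continuous second partial derivatives in a neighbourhood of $\theta_0$. Estimators. A minimum $\phi$-divergence estimator $\hat\theta_n^\phi$ is a $\Theta$-valued estimator based on the sample of size $n$ with $\hat\theta_n^\phi\in\operatorname{arg\,min}_{\theta\in\Theta} d_\phi(P,g(\theta))$, where $d_\phi(P,g(\theta))=\sum_{i=1}^k g_i(\theta)\,\phi\left(\frac{p_i}{g_i(\theta)}\right)$ for a continuous convex $\phi:[0,\infty)\to\mathbb{R}\cup\{\infty\}$ with $\phi(1)=0$,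 $0\phi(0/0)=0$, $0\phi(t/0)=t\lim_{u\to\infty}\phi(u)/u$ for $t>0$. It is BAN (best asymptotically normal) if it is asymptotically normal and asymptotically efficient, i.e. $\sqrt n(\hat\theta_n^\phi-\theta_0)\xrightarrow{d}\mathcal N(\mathbf 0,I_{\theta_0}^{-1})$, where $I_{\theta}$ is the Fisher information matrix of the multinomial model with $k$ cells and cell probabilities $g(\theta)$, so $I_{\theta_0}=\left(\frac{\partial g(\theta_0)}{\partial\theta}\right)^{\top}\mathrm{diag}\left(\frac{1}{g_1(\theta_0)},\ldots,\frac1{g_k(\theta_0)}\right)\frac{\partial g(\theta_0)}{\partial\theta}$. Inequality curves. For $p\in(0,1)$, $qZ(p;Q_\theta)=1-\frac{Q_\theta(p/2)}{Q_\theta((1+p)/2)}$ and $qD(p;Q_\theta)=1-\frac{Q_\theta(p/2)}{Q_\theta(1-p/2)}$; moreover $qZ(0;Q_\theta)=qZ(1;Q_\theta)=1$, $qD(0;Q_\theta)=1$, $qD(1;Q_\theta)=0$. *)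

(* Defs.v *)
From HB Require Import structures.
From mathcomp Require Import all_boot all_order all_algebra.
From mathcomp Require Import all_classical all_reals all_analysis.

Set Implicit Arguments.
Unset Strict Implicit.
Unset Printing Implicit Defensive.

Import Order.TTheory GRing.Theory Num.Theory.
Import numFieldNormedType.Exports.

Local Open Scope classical_set_scope.
Local Open Scope ring_scope.

(* Points of R^s and R^k are column vectors, so that the k x s Jacobian acts on
   the left: g t = g t0 + J *m (t - t0) + o(t - t0). *)

Section inequality_curves.
Context {R : realType}.

Definition nneg_reals : set R := [set x | 0 <= x].

Definition abs_continuous_on (D : set R) (f : R -> R) : Prop :=
  forall eps : R, 0 < eps -> exists2 delta : R, 0 < delta &
    forall (m : nat) (a b : 'I_m -> R),
      (forall i, a i <= b i /\ `[a i, b i] `<=` D) ->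
      trivIset [set: 'I_m] (fun i => `]a i, b i[%classic) ->
      \sum_i (b i - a i) < delta ->
      \sum_i `|f (b i) - f (a i)| < eps.

(* The inverse of the restriction of [f] to [0, +oo[. Where [f] does not take
   the value [p] there, [quantile f p] is 0. *)
Definition quantile (f : R -> R) : R -> R := 'pinv_(fun=> 0) nneg_reals f.

Definition qZ (p : R) (Q : R -> R) : R :=
  if (p == 0) || (p == 1) then 1 else 1 - Q (p / 2) / Q ((1 + p) / 2).

Definition qD (p : R) (Q : R -> R) : R :=
  if p == 0 then 1 else if p == 1 then 0 else 1 - Q (p / 2) / Q (1 - p / 2).

End inequality_curves.

Section grouped_data.
Context {R : realType}.

(* [c] is used at the indices 0, ..., k only. *)
Definition cutpoints (k : nat) (c : nat -> \bar R) : Prop :=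
  [/\ c 0%N = 0%:E, c k = +oo%E & forall i, (i < k)%N -> (c i < c i.+1)%E].

Definition cell (c : nat -> \bar R) (i : nat) : set R :=
  [set x | (c i <= x%:E < c i.+1)%E].

(* [None] occurs only for [x < 0]. *)
Definition observed_cell (k : nat) (c : nat -> \bar R) (x : R) : option 'I_k :=
  [pick i : 'I_k | `[< cell c i x >]].

Definition ext_cdf (f : R -> R) (x : \bar R) : R :=
  match x with x%:E => f x | +oo%E => 1 | -oo%E => 0 end.

Definition cell_prob (s k : nat) (c : nat -> \bar R)
    (F : 'cV[R]_s -> R -> R) (t : 'cV[R]_s) : 'cV[R]_k :=
  \col_(i < k) (ext_cdf (F t) (c i.+1) - ext_cdf (F t) (c i)).

Definition frequencies (T : Type) (k : nat) (c : nat -> \bar R)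
    (X : nat -> T -> R) (n : nat) (w : T) : 'cV[R]_k :=
  \col_(i < k) (n%:R^-1 * \sum_(j < n) \1_(cell c i) (X j w)).

Definition grouped_sample (T : Type) (k : nat) (c : nat -> \bar R)
    (X : nat -> T -> R) (n : nat) (w : T) : {ffun 'I_n -> option 'I_k} :=
  [ffun j : 'I_n => observed_cell k c (X j w)].

End grouped_data.

Section jacobian_fisher.
Context {R : realType} {s k : nat}.
Implicit Types (g : 'cV[R]_s -> 'cV[R]_k) (t : 'cV[R]_s).

Definition basis_vec (j : 'I_s) : 'cV[R]_s := delta_mx j 0.

Definition coord_fun g (i : 'I_k) : 'cV[R]_s -> R := fun t => g t i 0.

Definition partial g (i : 'I_k) (j : 'I_s) : 'cV[R]_s -> R :=
  fun t => 'D_(basis_vec j) (coord_fun g i) t.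

Definition jacobian_mx g t : 'M[R]_(k, s) := \matrix_(i, j) partial g i j t.

Definition totally_differentiable g t0 : Prop :=
  (forall i j, derivable (coord_fun g i) t0 (basis_vec j)) /\
  (fun t => g t - g t0 - jacobian_mx g t0 *m (t - t0))
    =o_ t0 (fun t => t - t0).

Definition C2_near g t0 : Prop :=
  \forall t \near t0, forall (i : 'I_k) (j l : 'I_s),
    [/\ derivable (coord_fun g i) t (basis_vec j),
        derivable (partial g i j) t (basis_vec l) &
        {for t, continuous (fun u => 'D_(basis_vec l) (partial g i j) u)}].

Definition fisher_info g t : 'M[R]_s :=
  (jacobian_mx g t)^T *m diag_mx (\row_(i < k) (g t i 0)^-1) *m jacobian_mx g t.

End jacobian_fisher.

Section phi_divergence.
Context {R : realType}.
Local Open Scope ereal_scope.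

(* [phi] is only constrained on [0, +oo[. *)
Definition divergence_fun (phi : R -> \bar R) : Prop :=
  [/\ forall x : R, (0 <= x)%R -> phi x != -oo,
      {within nneg_reals, continuous phi},
      forall x y t : R, (0 <= x)%R -> (0 <= y)%R -> (0 <= t <= 1)%R ->
        phi (t * x + (1 - t) * y)%R <= t%:E * phi x + (1 - t)%:E * phi y &
      phi 1%R = 0].

Definition phi_term (phi : R -> \bar R) (p q : R) : \bar R :=
  if q == 0%R then
    if p == 0%R then 0
    else p%:E * lim ((phi u * (u^-1)%:E) @[u --> +oo%R])
  else q%:E * phi (p / q)%R.

Definition phi_div (k : nat) (phi : R -> \bar R) (p q : 'cV[R]_k) : \bar R :=
  \sum_(i < k) phi_term phi (p i ord0) (q i ord0).

End phi_divergence.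

Definition argmin {R : realType} (T : Type) (D : set T) (f : T -> \bar R) :
    set T :=
  [set x | D x /\ forall y, D y -> (f x <= f y)%E].

Definition mutually_independent {R : realType} (d : measure_display)
    (Omega : measurableType d) (Pr : probability Omega R)
    (X : nat -> Omega -> R) : Prop :=
  forall (J : seq nat) (B : nat -> set R), uniq J ->
    (forall j, measurable (B j)) ->
    Pr (\bigcap_(j in [set` J]) X j @^-1` B j)
      = (\prod_(j <- J) Pr (X j @^-1` B j))%E.

Definition cvg_in_probability {R : realType} (d : measure_display)
    (Omega : measurableType d) (Pr : probability Omega R)
    (Y : nat -> Omega -> R) (y : R) : Prop :=
  forall eps : R, 0 < eps ->
    Pr [set w | eps < `|Y n w - y|] @[n --> \oo] --> 0%E.

Definition borel_cV (R : realType) (s : nat) :=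
  g_sigma_algebraType (@open 'cV[R]_s).

(* [normal_prob m 0] is not the point mass at [m], hence the case split. *)
Definition normal_law1 {R : realType} (m v : R) (B : set R) : \bar R :=
  if v == 0 then \d_m B else normal_prob m (Num.sqrt v) B.

(* [mu] is N(m, Sigma) when every linear functional a^T x is distributed as
   N(a^T m, a^T Sigma a). *)
Definition is_multinormal {R : realType} {s : nat} (m : 'cV[R]_s)
    (Sigma : 'M[R]_s) (mu : probability (borel_cV R s) R) : Prop :=
  forall (a : 'cV[R]_s) (B : set R), measurable B ->
    mu [set x : 'cV[R]_s | B ((a^T *m x) 0 0)]
      = normal_law1 ((a^T *m m) 0 0) ((a^T *m Sigma *m a) 0 0) B.

Definition cvg_in_distribution {R : realType} (d : measure_display)
    (Omega : measurableType d) (Pr : probability Omega R) {s : nat}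
    (Y : nat -> Omega -> 'cV[R]_s) (mu : probability (borel_cV R s) R) : Prop :=
  forall f : 'cV[R]_s -> R, continuous f ->
    (exists M : R, forall x, `|f x| <= M) ->
    (\int[Pr]_w (f (Y n w))%:E)%E @[n --> \oo] --> (\int[mu]_x (f x)%:E)%E.

Section estimators.
Context {R : realType} {d : measure_display} {Omega : measurableType d}.
Context {s : nat}.

(* The data of size [n] is the array of the cells containing X_0, ..., X_{n-1},
   so an estimator is a function of that array. *)
Definition estimator (k : nat) :=
  forall n : nat, {ffun 'I_n -> option 'I_k} -> 'cV[R]_s.

Definition estimate (k : nat) (T : estimator k) (c : nat -> \bar R)
    (X : nat -> Omega -> R) (n : nat) (w : Omega) : 'cV[R]_s :=
  T n (grouped_sample k c X n w).

Definition min_phi_div_estimator (k : nat) (phi : R -> \bar R)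
    (Theta : set 'cV[R]_s) (g : 'cV[R]_s -> 'cV[R]_k) (c : nat -> \bar R)
    (X : nat -> Omega -> R) (T : estimator k) : Prop :=
  forall (n : nat) (w : Omega), (0 < n)%N ->
    argmin Theta (fun t => phi_div phi (frequencies k c X n w) (g t))
      (estimate T c X n w).

Definition BAN (k : nat) (Pr : probability Omega R)
    (g : 'cV[R]_s -> 'cV[R]_k) (t0 : 'cV[R]_s)
    (that : nat -> Omega -> 'cV[R]_s) : Prop :=
  exists2 mu : probability (borel_cV R s) R,
    is_multinormal 0 (invmx (fisher_info g t0)) mu &
    cvg_in_distribution Pr (fun n w => Num.sqrt n%:R *: (that n w - t0)) mu.

End estimators.

(* Main.v *)
Require Import Defs.
From HB Require Import structures.
From mathcomp Require Import all_boot all_order all_algebra.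
From mathcomp Require Import all_classical all_reals all_analysis.
From mathcomp Require Import measurable_realfun lra.

Set Implicit Arguments.
Unset Strict Implicit.
Unset Printing Implicit Defensive.

Import Order.TTheory GRing.Theory Num.Theory.
Import numFieldNormedType.Exports.

Local Open Scope classical_set_scope.
Local Open Scope ring_scope.

(** The curves at a fixed [p] are continuous functions of the parameter at
    [t0], so the theorem is the continuous mapping theorem applied to a
    consistent estimator.

    Consistency comes from asymptotic normality alone. A sequence that
    converges in distribution is bounded in probability
    ([cvg_in_distribution_tight]), and [sqrt n * (that - t0)] bounded in
    probability with [sqrt n] unbounded forces [that - t0] to 0 in probability
    ([root_n_consistent]).

    For [0 < p < 1] the curves are [1 - Q_t(a) / Q_t(b)] with [a] and [b] in
    ]0, 1[. Quantiles are continuous in [t] relative to the parameter set, hence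
    continuous at the interior point [t0], and the denominator does not vanish
    there: [F t0] is continuous and increases from 0 at 0 towards 1, so its
    quantiles of order in ]0, 1[ are positive ([quantile_gt0]). At [p = 0] and
    [p = 1] the curves do not depend on the parameter.

    The events in the conclusion have to be measurable for their probabilities
    to be compared, while neither [T] nor the curves away from [t0] are assumed
    measurable. An estimator that sees only the cells of the observations is a
    function of a measurable map into a finite set, so that the preimage of any
    set at all is measurable ([measurable_estimate]). *)

(** * Positivity of quantiles *)

Section quantiles.
Context {R : realType}.
Implicit Types (f : R -> R) (D : set R).

(** A single interval in the definition of absolute continuity gives
    continuity; [D] has to contain the interval between two of its points. *)
Lemma abs_continuous_within D f : is_interval D ->
  abs_continuous_on D f -> {within D, continuous f}.
Proof.
move=> itvD fD; apply/subspace_continuousP => x Dx; apply/cvgrPdist_lt => e e0.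
have [dl dl0 fdl] := fD e e0.
have step y z : D y -> D z -> y <= z -> z - y < dl -> `|f z - f y| < e.
  move=> Dy Dz yz zydl.
  have := fdl 1%N (fun=> y) (fun=> z); rewrite !big_ord1; apply => //.
  - move=> i; split=> // u /=; rewrite in_itv /= => yuz.
    exact: itvD Dy Dz _ yuz.
  - by move=> i j _ _ _; rewrite !ord1.
apply/nbhs_normP; exists dl => //= y /= xy Dy.
have [le_xy|lt_yx] := leP x y.
  by rewrite distrC step//; apply: le_lt_trans xy; rewrite distrC ler_norm.
by rewrite step// ?ltW//; apply: le_lt_trans xy; rewrite ler_norm.
Qed.

(** The intermediate value theorem on [0, M], with [M] beyond the quantile,
    shows that the order [r] is attained, so that the default value 0 of
    [quantile] is not used; it is not attained at 0 as [f 0 = 0 < r]. *)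
Lemma quantile_gt0 (f : cumulativeBounded (0 : R) (1 : R)) (r : R) :
  abs_continuous_on nneg_reals f ->
  {in nneg_reals &, {homo f : x y / x < y}} ->
  f 0 = 0 -> 0 < r < 1 -> 0 < quantile f r.
Proof.
move=> acf incf f0 /andP[r0 r1].
have [M [M0 rM]] : exists M : R, 0 <= M /\ r < f M.
  have : \forall x \near +oo, r < f x.
    by apply: (cvgr_gt 1) => //; exact: cumulativey.
  move=> [A [_ rA]]; exists (Num.max 0 (A + 1)); split.
    by rewrite le_max lexx.
  by apply: rA; rewrite lt_max ltrDl ltr01 orbT.
have cf : {within `[0, M], continuous f}.
  apply: (@continuous_subspaceW _ _ _ nneg_reals).
    by move=> x /=; rewrite in_itv /= => /andP[].
  apply: abs_continuous_within => // x y x0 _ z /andP[xz _].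
  exact: le_trans xz.
have [|x] := @IVT _ f 0 M r M0 cf.
  by rewrite f0 ge_min le_max !(ltW r0) (ltW rM) orbT.
rewrite in_itv /= => /andP[x0 _] fx.
have -> : quantile f r = x.
  rewrite -fx /quantile pinvKV ?inE// => y z yD zD fyz.
  have [yz|zy|//] := ltgtP y z.
    by have := incf _ _ yD zD yz; rewrite fyz ltxx.
  by have := incf _ _ zD yD zy; rewrite fyz ltxx.
rewrite lt_neqAle x0 andbT; apply: contraTneq r0 => x_eq0.
by rewrite -fx -x_eq0 f0 ltxx.
Qed.

End quantiles.

(** * Continuity of the inequality curves in the parameter *)

Section curves.
Context {R : realType} {U : topologicalType} (Q : U -> R -> R) (t0 : U)
  (Qc : forall r, 0 < r < 1 -> {for t0, continuous (fun t => Q t r)})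
  (Q0 : forall r, 0 < r < 1 -> Q t0 r != 0).

Lemma quantile_ratio_continuous (a b : R) : 0 < a < 1 -> 0 < b < 1 ->
  {for t0, continuous (fun t => 1 - Q t a / Q t b)}.
Proof.
move=> a01 b01; apply: cvgB; first exact: cvg_cst.
by apply: cvgM; [exact: Qc|apply: cvgV; [exact: Q0|exact: Qc]].
Qed.

Lemma qZ_continuous (p : R) : 0 <= p <= 1 ->
  {for t0, continuous (fun t => qZ p (Q t))}.
Proof.
move=> /andP[p0 p1]; rewrite /qZ.
have [_|pN0] := eqVneq p 0; first exact: cvg_cst.
have [_|pN1] := eqVneq p 1; first exact: cvg_cst.
have {pN0 p0}p0 : 0 < p by rewrite lt_neqAle eq_sym pN0.
have {pN1 p1}p1 : p < 1 by rewrite lt_neqAle pN1.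
by apply: quantile_ratio_continuous; lra.
Qed.

Lemma qD_continuous (p : R) : 0 <= p <= 1 ->
  {for t0, continuous (fun t => qD p (Q t))}.
Proof.
move=> /andP[p0 p1]; rewrite /qD.
have [_|pN0] := eqVneq p 0; first exact: cvg_cst.
have [_|pN1] := eqVneq p 1; first exact: cvg_cst.
have {pN0 p0}p0 : 0 < p by rewrite lt_neqAle eq_sym pN0.
have {pN1 p1}p1 : p < 1 by rewrite lt_neqAle pN1.
by apply: quantile_ratio_continuous; lra.
Qed.

End curves.

(** * Measurability of statistics of grouped data *)

Section grouping.
Context {R : realType} {d : measure_display} {Omega : measurableType d}.
Context (Pr : probability Omega R).

Lemma measurable_cell (c : nat -> \bar R) i : measurable (cell c i).
Proof.
have -> : cell c i = EFin @^-1` `[c i, c i.+1[%classic.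
  by apply/seteqP; split=> x /=; rewrite in_itv.
rewrite -[X in measurable X]setTI.
by apply: EFin_measurable => //; exact: emeasurable_itv.
Qed.

(** The observed cell is determined by the finitely many booleans telling which
    cells contain the observation. Going through them avoids describing
    [pick]'s choice among several cells, since the cells need not be disjoint
    for arbitrary [c]. *)
Lemma measurable_observed_cell k (c : nat -> \bar R) (S : set (option 'I_k)) :
  measurable (observed_cell k c @^-1` S).
Proof.
pose code (x : R) : {ffun 'I_k -> bool} :=
  [ffun i : 'I_k => `[< cell c i x >]].
pose decode (b : {ffun 'I_k -> bool}) : option 'I_k := [pick i | b i].
have E x : observed_cell k c x = decode (code x).
  by rewrite /observed_cell /decode; apply: eq_pick => i; rewrite ffunE.
have -> : observed_cell k c @^-1` S =
    \bigcup_(b in decode @^-1` S) \bigcap_(i in [set: 'I_k])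
      [set x | cell c (i : 'I_k) x <-> b i].
  apply/seteqP; split=> [x Sx|x [b Sb bx]].
    exists (code x); first by rewrite /= -E.
    by move=> i _ /=; rewrite ffunE; split=> /asboolP.
  rewrite /preimage /= E; suff -> : code x = b by [].
  apply/ffunP => i; rewrite ffunE; apply/asboolP/idP => /bx; exact.
apply: fin_bigcup_measurable => // b _.
apply: fin_bigcap_measurable => // i _.
case: (b i).
  rewrite (_ : [set _ | _] = cell c i); first exact: measurable_cell.
  by apply/seteqP; split=> x /= => [[_]|//]; apply.
rewrite (_ : [set _ | _] = ~` cell c i).
  by apply: measurableC; exact: measurable_cell.
by apply/seteqP; split=> x /=; [case=> cf _ /cf|split].
Qed.

Lemma measurable_grouped_sample k (c : nat -> \bar R)
    (X : nat -> {RV Pr >-> R}) n (S : set {ffun 'I_n -> option 'I_k}) :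
  measurable (grouped_sample k c (fun j => X j) n @^-1` S).
Proof.
have -> : grouped_sample k c (fun j => X j) n @^-1` S =
    \bigcup_(b in S) \bigcap_(j in [set: 'I_n])
      X j @^-1` (observed_cell k c @^-1` [set b j]).
  apply/seteqP; split=> [w Sw|w [b Sb bw]].
    by exists (grouped_sample k c (fun j => X j) n w) => // j _ /=;
      rewrite ffunE.
  rewrite /preimage /=.
  suff -> : grouped_sample k c (fun j => X j) n w = b by [].
  by apply/ffunP => j; rewrite ffunE; apply: bw.
apply: fin_bigcup_measurable => // b _.
apply: fin_bigcap_measurable => // j _.
rewrite -[X in measurable X]setTI; apply: measurable_funP => //.
exact: measurable_observed_cell.
Qed.

Lemma measurable_estimate s k (T : @estimator R s k) (c : nat -> \bar R)
    (X : nat -> {RV Pr >-> R}) n (A : set 'cV[R]_s) :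
  measurable (estimate T c (fun j => X j) n @^-1` A).
Proof. exact: (measurable_grouped_sample c X (T n @^-1` A)). Qed.

End grouping.

(** * Convergence in distribution and consistency *)

Lemma nonneg_near_lt_cvge0 (R : realType) (u : nat -> \bar R) :
  (forall n, (0 <= u n)%E) ->
  (forall e : R, 0 < e -> \forall n \near \oo, (u n < e%:E)%E) ->
  u n @[n --> \oo] --> 0%E.
Proof.
move=> u0 ue; apply/fine_cvgP; split.
  apply: filterS (ue 1 ltr01) => n un1.
  by rewrite ge0_fin_numE// (lt_trans un1) ?ltry.
apply/(@cvgr0Pnorm_lt R R^o) => e e0; apply: filterS (ue e e0) => n /= une.
rewrite ger0_norm ?fine_ge0// -lte_fin fineK//.
by rewrite ge0_fin_numE// (lt_trans une) ?ltry.
Qed.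

Lemma near_le_sqrt (R : realType) (K : R) :
  \forall n \near \oo, K <= Num.sqrt n%:R.
Proof.
apply: filterS (nbhs_infty_ger (K ^+ 2)) => n Kn.
apply: le_trans (ler_norm K) _; rewrite -sqrtr_sqr.
by rewrite ler_wsqrtr.
Qed.

Section tightness.
Context {R : realType} {s : nat}.

Lemma continuous_measurable_borel_cV (f : 'cV[R]_s -> R) :
  continuous f -> measurable_fun setT (f : borel_cV R s -> R).
Proof.
move=> fc; apply: (measurability _ (RGenOInfty.measurableE R)).
move=> _ [_ [a ->] <-]; rewrite setTI; apply: sub_sigma_algebra.
by apply: open_comp => // x _; exact: fc.
Qed.

(** A continuous function with values in [0, 1] that is 1 outside the ball of
    radius [n.+1]; it stands in for the indicator of that set, which is
    discontinuous and hence no test function for convergence in distribution. *)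
Definition capped_norm (n : nat) (x : 'cV[R]_s) : R :=
  Num.min 1 (`|x| / n.+1%:R).

Lemma capped_norm_ge0 n x : 0 <= capped_norm n x.
Proof. by rewrite le_min ler01 divr_ge0. Qed.

Lemma capped_norm_le1 n x : capped_norm n x <= 1.
Proof. by rewrite ge_min lexx. Qed.

Lemma capped_norm_eq1 n x : n.+1%:R <= `|x| -> capped_norm n x = 1.
Proof. by move=> nx; apply/min_idPl; rewrite ler_pdivlMr// mul1r. Qed.

Lemma continuous_capped_norm n : continuous (capped_norm n).
Proof.
move=> x.
apply: (@continuous_min R 'cV[R]_s (cst 1) (fun y => `|y| / n.+1%:R)).
  exact: cst_continuous.
exact: (cvgMr_tmp (@norm_continuous R 'cV[R]_s x)).
Qed.

Lemma integral_capped_norm_cvg0 (mu : probability (borel_cV R s) R) :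
  (\int[mu]_x (capped_norm n x)%:E)%E @[n --> \oo] --> 0%E.
Proof.
rewrite -[X in _ --> X](integral0 mu setT).
apply: (@dominated_cvg _ _ _ mu _ measurableT _ _ (cst 1%E)) => //.
- move=> n; apply/measurable_EFinP.
  exact: (continuous_measurable_borel_cV (@continuous_capped_norm n)).
- move=> x _; apply: cvg_EFin; first exact: nearW.
  apply: (@squeeze_cvgr _ _ _ _ (cst 0) (fun n => `|x| * n.+1%:R^-1)).
  + near=> n; rewrite /= capped_norm_ge0 /capped_norm ge_min lexx orbT//.
  + exact: cvg_cst.
  + rewrite -[X in _ --> X](mulr0 `|x|); apply: cvgMl_tmp; exact: cvg_harmonic.
- exact: (finite_measure_integrable_cst mu 1).
- by move=> n x _ /=; rewrite lee_fin ger0_norm ?capped_norm_ge0 ?capped_norm_le1.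
Unshelve. all: end_near. Qed.

Context {d : measure_display} {Omega : measurableType d}.
Context (Pr : probability Omega R).

(** By [capped_norm_eq1], the probability that [Y n] leaves the ball of radius
    [m.+1] is at most the expectation of [capped_norm m (Y n)], which tends to
    the integral under the limit law; that integral is small for [m] large. *)
Lemma cvg_in_distribution_tight (Y : nat -> Omega -> 'cV[R]_s)
    (mu : probability (borel_cV R s) R) :
  (forall n, measurable_fun setT (Y n : Omega -> borel_cV R s)) ->
  cvg_in_distribution Pr Y mu ->
  forall e : R, 0 < e -> exists K : R, \forall n \near \oo,
    (Pr [set w | (K <= `|Y n w|)%R ] < e%:E)%E.
Proof.
move=> mY Ymu e e0.
have [m me] : exists m, (\int[mu]_x (capped_norm m x)%:E < e%:E)%E.
  have : \forall m \near \oo, (\int[mu]_x (capped_norm m x)%:E < e%:E)%E.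
    exact: (@integral_capped_norm_cvg0 mu _ (open_ereal_lt' _)).
  by move=> [m _ /(_ m) me]; exists m; apply: me => /=.
exists m.+1%:R.
have cm_bounded : exists M : R, forall x, `|capped_norm m x| <= M.
  by exists 1 => x; rewrite ger0_norm ?capped_norm_ge0 ?capped_norm_le1.
have : \forall n \near \oo, (\int[Pr]_w (capped_norm m (Y n w))%:E < e%:E)%E.
  exact: (Ymu _ (@continuous_capped_norm m) cm_bounded _ (open_ereal_lt' me)).
apply: filterS => n; apply: le_lt_trans.
have mnY : measurable [set w | m.+1%:R <= `|Y n w| ].
  rewrite -[X in measurable X]setTI.
  apply: (mY n measurableT [set x | m.+1%:R <= `|x| ]).
  rewrite -[X in measurable X]setTI.
  have mnrm := continuous_measurable_borel_cV (@norm_continuous R 'cV[R]_s).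
  rewrite (_ : [set x | _] = Num.norm @^-1` `[m.+1%:R, +oo[%classic).
    by apply: mnrm.
  by apply/seteqP; split => x /=; rewrite in_itv /= andbT.
rewrite -[X in Pr X]setIT -integral_indic//; apply: ge0_le_integral => //.
- apply/measurable_EFinP; exact: measurable_indic.
- apply/measurable_EFinP.
  exact: (measurableT_comp (continuous_measurable_borel_cV
    (@continuous_capped_norm m)) (mY n)).
- move=> w _; rewrite lee_fin indicE; case: (boolP (w \in _)); rewrite ?inE.
    by move=> /capped_norm_eq1 ->.
  by rewrite capped_norm_ge0.
Qed.

(** If [Z n] is [dl] away from [z], then [sqrt n * (Z n - z)] has norm at least
    [sqrt n * dl], which exceeds any bound given by tightness. *)
Lemma root_n_consistent (Z : nat -> Omega -> 'cV[R]_s) (z : 'cV[R]_s)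
    (mu : probability (borel_cV R s) R) :
  (forall n (A : set 'cV[R]_s), measurable (Z n @^-1` A)) ->
  cvg_in_distribution Pr (fun n w => Num.sqrt n%:R *: (Z n w - z)) mu ->
  cvg_in_probability Pr (fun n w => `|Z n w - z|) 0.
Proof.
move=> mZ Zmu dl dl0; apply: nonneg_near_lt_cvge0 => // e e0.
have mY n : measurable_fun setT
    (fun w => Num.sqrt n%:R *: (Z n w - z) : borel_cV R s).
  move=> _ B _; rewrite setTI.
  exact: (mZ n [set x | B (Num.sqrt n%:R *: (x - z))]).
have [K] := cvg_in_distribution_tight mY Zmu e0.
apply: filterS2 (near_le_sqrt (K / dl)) => n Kn; apply: le_lt_trans.
apply: le_measure; rewrite ?inE.
- exact: (mZ n [set x | dl < `| `|x - z| - 0| ]).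
- exact: (mZ n [set x | K <= `|Num.sqrt n%:R *: (x - z)| ]).
- move=> w /=; rewrite subr0 normr_id normrZ ger0_norm ?sqrtr_ge0// => dlw.
  apply: le_trans (_ : K / dl * dl <= _); first by rewrite divfK ?gt_eqF.
  by rewrite (le_trans (ler_wpM2r (ltW dl0) Kn))// ler_wpM2l ?sqrtr_ge0 ?ltW.
Qed.

(** [q] is continuous at [z] only and may be non-measurable, which is why all
    preimages under [Z n] are required to be measurable. *)
Lemma cvg_in_probability_continuous (Z : nat -> Omega -> 'cV[R]_s)
    (z : 'cV[R]_s) (q : 'cV[R]_s -> R) :
  (forall n (A : set 'cV[R]_s), measurable (Z n @^-1` A)) ->
  cvg_in_probability Pr (fun n w => `|Z n w - z|) 0 ->
  {for z, continuous q} ->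
  cvg_in_probability Pr (fun n w => q (Z n w)) (q z).
Proof.
move=> mZ Zz qc e e0.
have /nbhs_normP[dl /= dl0 qdl] : \forall x \near z, `|q z - q x| < e.
  exact: (@cvgr_dist_lt R R^o _ _ _ _ _ qc).
(* The complement of the closed ball of radius dl / 2 is a strict event, as in
   convergence in probability, and that closed ball lies in the open ball dl. *)
have dl20 : 0 < dl / 2 by rewrite divr_gt0.
apply: (squeeze_cvge _ (cvg_cst 0%E) (Zz _ dl20)).
apply: nearW => n; rewrite measure_ge0 /=.
apply: le_measure; rewrite ?inE.
- exact: (mZ n [set x | e < `|q x - q z| ]).
- exact: (mZ n [set x | dl / 2 < `| `|x - z| - 0| ]).
- move=> w /=; rewrite subr0 normr_id => eq; rewrite ltNge; apply/negP => Zw.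
  have /qdl : ball_ Num.norm z dl (Z n w).
    by rewrite /= distrC (le_lt_trans Zw)// ltr_pdivrMr// ltr_pMr// ltr1n.
  by rewrite /= distrC ltNge (ltW eq).
Qed.

End tightness.

(** * Consistency of the estimated inequality curves *)

Theorem theorem3p4 (R : realType) (d : measure_display)
    (Omega : measurableType d) (Pr : probability Omega R)
    (s k : nat) (s_gt0 : (0 < s)%N) (k_gt : (s.+1 < k)%N)
    (Theta : set 'cV[R]_s) (F : 'cV[R]_s -> cumulativeBounded (0 : R) (1 : R))
    (t0 : 'cV[R]_s)
    (X : nat -> {RV Pr >-> R})
    (X_ge0 : forall j w, 0 <= X j w)
    (X_indep : mutually_independent Pr (fun j => X j))
    (X_cdf : forall j x, cdf (X j) x = (F t0 x)%:E)
    (c : nat -> \bar R) (c_cut : cutpoints k c)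
    (g : 'cV[R]_s -> 'cV[R]_k) (g_def : g = cell_prob k c (fun t => F t))
    (A1 : forall t, Theta t ->
      [/\ abs_continuous_on nneg_reals (F t),
          {in nneg_reals &, {homo F t : x y / x < y}} &
          F t 0 = 0])
    (A2 : Theta^° t0 /\ compact Theta)
    (A3 : forall p : R, 0 < p < 1 ->
      {within Theta, continuous (fun t => quantile (F t) p)})
    (B1 : forall i, 0 < g t0 i 0)
    (B2 : totally_differentiable g t0)
    (B3 : \rank (jacobian_mx g t0) = s)
    (B4 : set_inj Theta g /\
      'pinv_(fun=> 0) Theta g y @[y --> within (g @` Theta) (nbhs (g t0))]
        --> 'pinv_(fun=> 0) Theta g (g t0))
    (B5 : {within Theta, continuous g})
    (B6 : C2_near g t0)
    (phi : R -> \bar R) (phi_div_fun : divergence_fun phi)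
    (T : estimator k)
    (T_min : min_phi_div_estimator phi Theta g c (fun j => X j) T)
    (T_BAN : BAN Pr g t0 (estimate T c (fun j => X j)))
    (p : R) (p01 : 0 <= p <= 1) :
  cvg_in_probability Pr
    (fun n w => qZ p (quantile (F (estimate T c (fun j => X j) n w))))
    (qZ p (quantile (F t0)))
  /\
  cvg_in_probability Pr
    (fun n w => qD p (quantile (F (estimate T c (fun j => X j) n w))))
    (qD p (quantile (F t0))).
Proof.
have [intT _] := A2.
have Tt0 : Theta t0 by exact: interior_subset.
have [acF incF F0] := A1 _ Tt0.
pose Q t := quantile (F t).
have Qc r : 0 < r < 1 -> {for t0, continuous (fun t => Q t r)}.
  move=> r01; have := A3 r r01; rewrite subspace_continuousP => /(_ _ Tt0).
  by rewrite within_interior.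
have Q0 r : 0 < r < 1 -> Q t0 r != 0.
  by move=> r01; rewrite gt_eqF// quantile_gt0.
have mT := measurable_estimate T c X.
have T_consistent : cvg_in_probability Pr
    (fun n w => `|estimate T c (fun j => X j) n w - t0|) 0.
  by have [mu _] := T_BAN; exact: root_n_consistent.
split.
- exact: (cvg_in_probability_continuous mT T_consistent
    (qZ_continuous Qc Q0 p01)).
- exact: (cvg_in_probability_continuous mT T_consistent
    (qD_continuous Qc Q0 p01)).
Qed.
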